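(* Let $p$ and $q$ be two curves in $\mathbb{CP}^2$, with $\deg p=k$, $\deg q=s$ and $k\ge s\ge 3$, intersecting transversely in a $0$-dimensional variety $\Gamma$. Then for any subvariety $\Gamma'\subseteq\Gamma$ such that $\operatorname{Dep}_s(\Gamma')\ge 1$ we have $$\operatorname{Ind}_s(\Gamma')-\operatorname{Dep}_s(\Gamma')\ \ge\ \operatorname{Ind}_s(\Gamma)-\operatorname{Dep}_s(\Gamma).$$
   Context: For a finite set of points $\Gamma\subset\mathbb{CP}^{n-1}$ with ideal $I(\Gamma)\subset\mathbb{C}[x]=\mathbb{C}[x_1,\dots,x_n]$, $\operatorname{Ind}_m(\Gamma)$ is the number of linearly independent functionals among the evaluations at (affine representatives of) the points of $\Gamma$ on forms of degree $m$, i.e. $\operatorname{Ind}_m(\Gamma)=\dim(\mathbb{C}[x]/I(\Gamma))_m$, and $\operatorname{Dep}_m(\Gamma)=|\Gamma|-\operatorname{Ind}_m(\Gamma)$ is the dimension of the space of linear relations among these evaluation functionals. Transverse intersection of the two curves means that $\Gamma$ consists of $ks$ distinct points. *)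

(* Defs.v *)
From HB Require Import structures.
From mathcomp Require Import all_boot all_order all_algebra finmap.
From mathcomp Require Import complex mpoly reals.

Set Implicit Arguments.
Unset Strict Implicit.
Unset Printing Implicit Defensive.

Import GRing.Theory.

Local Open Scope ring_scope.

(* Projective space over F of dimension n: its points are the lines through
   the origin of F^(n+1). *)
Record proj (n : nat) (F : fieldType) := Proj {
  line_of : {vspace 'rV[F]_n.+1};
  _ : \dim line_of == 1%N
}.

HB.instance Definition _ n F := [isSub for @line_of n F].
HB.instance Definition _ n F := [Choice of @proj n F by <:].

Section Evaluation.

Variables (n : nat) (F : fieldType).

(* [vpick L] is a nonzero vector of [L], so this is an affine representative
   of [x]. *)
Definition rep (x : proj n F) (i : 'I_n.+1) : F := vpick (line_of x) 0 i.

Lemma rep_neq0 (x : proj n F) : exists i, rep x i != 0.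
Proof.
case: x => L dimL; have : vpick L != 0.
  by rewrite vpick0; apply: contraTneq dimL => ->; rewrite dimv0.
by case/rV0Pn => i Hi; exists i.
Qed.

Definition eval (m : nat) (x : proj n F) (f : dhomog n.+1 F m) : F^o :=
  (mpoly_of_dhomog f).@[rep x].

Lemma eval_is_linear m x : linear (@eval m x).
Proof. by move=> a f g; rewrite /eval /= mevalD mevalZ. Qed.

HB.instance Definition _ m x :=
  GRing.isLinear.Build F (dhomog n.+1 F m) F^o _ (@eval m x)
    (@eval_is_linear m x).

Definition evalf (m : nat) (x : proj n F) : 'Hom(dhomog n.+1 F m, F^o) :=
  linfun (@eval m x).

Lemma evalfE m x f : evalf m x f = (mpoly_of_dhomog f).@[rep x].
Proof. by rewrite lfunE. Qed.

Definition Ind (m : nat) (G : {fset proj n F}) : nat :=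
  \dim <<[seq evalf m x | x <- G]>>.

Definition Dep (m : nat) (G : {fset proj n F}) : nat := (#|` G| - Ind m G)%N.

(* The subtraction in [Dep] is never truncated. *)
Lemma Ind_le_card m G : (Ind m G <= #|` G|)%N.
Proof. by rewrite /Ind (leq_trans (dim_span _)) // size_map. Qed.

(* The condition [p.@[rep x] = 0] does not depend on the representative of [x]
   since [p] is only ever homogeneous here. *)
Definition on_curve (p : {mpoly F[n.+1]}) (x : proj n F) : Prop :=
  p.@[rep x] = 0.

End Evaluation.

(* [p] is a form of degree [k] defining a curve of degree [k]. *)
Definition is_curve (F : fieldType) (k : nat) (p : {mpoly F[3]}) : Prop :=
  p \is k.-homog /\ p != 0.

(* The curves [p] and [q], of degrees [k] and [s], intersect transversely,
   exactly in [G]: they meet in [k * s] distinct points. *)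
Definition transverse_intersection (F : fieldType) (k s : nat)
    (p q : {mpoly F[3]}) (G : {fset proj 2 F}) : Prop :=
  (forall x, x \in G <-> on_curve p x /\ on_curve q x) /\ #|` G| = (k * s)%N.

(* Main.v *)
(* Let [c(i)] be the h-vector (first difference of the Hilbert function) of a
   subset [A] of Gamma, [l] a linear form without zeros on Gamma, and [D(j)] the
   space of linear relations on [A] among evaluations in degrees [< j], so that
   [c(i) = dim D(i) - dim D(i+1)] once the points are normalized by [l = 1].
   Multiplication by a linear form maps [D(j+1)] to [D(j)].  If [w] in [D(m+1)]
   stays in [D(m+1)] after multiplication by the equation of a line through a
   point [P] of [l = 0], then [w] acts on forms of degree [m + 1] as a multiple
   of evaluation at [P].  As forms vanishing on [A] are killed by [w], one gets:
   - [c(m) <= m + 1]; if [c(m) <= m] then [c(m+1) <= c(m)]; and [c(m) <= m] as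
     soon as a nonzero form of degree [m] vanishes on [A];
   - [c(m+1) < c(m)] if [m + 1 >= k] and [c(m) > 0]: otherwise the pencil of
     multiplications [D(m+1)/D(m+2) -> D(m)/D(m+1)] has a singular member,
     giving such a [w] outside [D(m+2)] for some [P], although [p] or [q] does
     not vanish at [P].
   For [A] = Gamma these bounds add up to [k s], so they are equalities.  This
   gives the Hilbert function of Gamma and (Cayley-Bacharach) a relation [w] in
   degree [k + s - 3] all of whose weights are nonzero; multiplication by [w]
   identifies forms of degree [k - 3] on Gamma with relations in degree [s].
   A relation on Gamma' in degree [s] thus yields a form of degree [k - 3] that
   vanishes on the complement [A] of Gamma' in Gamma, so [c(k-3) <= k - 3] for
   [A]; the bounds then give [c(k-2+j) <= c(k-3-j)] for all [j], i.e. [A]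
   imposes at least [|A|/2] conditions in degree [k - 3].  Multiplied by [w],
   these conditions become as many relations in degree [s] that are independent
   modulo the relations on Gamma'. *)

Require Import Defs.
From mathcomp Require Import all_boot all_order all_algebra finmap.
From mathcomp Require Import complex mpoly reals.
From mathcomp Require Import zify ring.

Set Implicit Arguments.
Unset Strict Implicit.
Unset Printing Implicit Defensive.

Import GRing.Theory VectorInternalTheory.

(** * h-vectors as numerical functions *)

Lemma sum_indicator_interval (s n M : nat) :
  \sum_(i < M) (s <= i < s + n : nat) = minn M (s + n) - s.
Proof.
elim: M => [|M IH]; first by rewrite big_ord0; lia.
rewrite big_ord_recr /= IH.
by case: (leqP s M) => h1; case: (ltnP M (s + n)) => h2 /=; lia.
Qed.

(* The h-vector [1, 2, .., s, .., s, .., 2, 1] of a complete intersection of two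
   plane curves of degrees [s <= k]. *)
Definition ci_hvector (k s i : nat) : nat := minn i.+1 (minn s (k + s - i.+1)).

(** Induction on [s]: raising [s] by one adds 1 exactly in the degrees from [s] to [s + k - 1]. *)
Lemma sum_ci_hvector (k s M : nat) :
  s <= k -> k + s <= M.+1 -> \sum_(i < M) ci_hvector k s i = k * s.
Proof.
elim: s => [|s IH] lesk leM.
  by rewrite muln0 big1 // => i _; rewrite /ci_hvector; lia.
have sumk : \sum_(i < M) (s <= i < s + k : nat) = k.
  by rewrite sum_indicator_interval; lia.
rewrite mulnS -IH; [|lia|lia]; rewrite -{2}sumk -big_split.
apply: eq_bigr => i _ /=; rewrite /ci_hvector.
by case: (leqP s i) => h1; case: (ltnP i (s + k)) => h2 /=; lia.
Qed.

(** By the symmetry [i -> k + s - 2 - i], the second sum is that of the degrees above [s]. *)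
Lemma sum_ci_hvector_sym (k s : nat) : s <= k -> 1 < k ->
  \sum_(i < s.+1) ci_hvector k s i + \sum_(i < k - 2) ci_hvector k s i = k * s.
Proof.
move=> sk k1; rewrite -(@sum_ci_hvector k s (s.+1 + (k - 2))) //; last by lia.
rewrite big_split_ord /=; congr addn; rewrite [RHS](reindex_inj rev_ord_inj) /=.
by apply: eq_bigr => i _; rewrite /ci_hvector; have := ltn_ord i; lia.
Qed.

Section HVector.

Variables (k : nat) (c : nat -> nat).
Hypothesis c_le : forall i, c i <= i.+1.
Hypothesis c_noninc : forall i, c i <= i -> c i.+1 <= c i.
Hypothesis c_decr : forall i, k <= i.+1 -> 0 < c i -> c i.+1 < c i.

Lemma hvector_noninc (i j : nat) : c i <= i -> i <= j -> c j <= c i.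
Proof.
move=> hi; elim: j => [|j IH] hj; first by have -> : i = 0 by lia.
case: (ltnP i j.+1) => h; last by have -> : i = j.+1 by lia.
by have := IH h; have := @c_noninc j; lia.
Qed.

Lemma hvector_ge (i j : nat) : i <= j -> minn i.+1 (c j) <= c i.
Proof.
move=> hij; case: (leqP (c i) i) => hi; last by lia.
by have := hvector_noninc hi hij; lia.
Qed.

Lemma hvector_tail (i j : nat) : k <= i.+1 -> c (i + j) <= c i - j.
Proof.
move=> hi; elim: j => [|j IH]; first by rewrite addn0 subn0.
rewrite addnS; case: (posnP (c (i + j))) => h.
  by have := @c_noninc (i + j); lia.
by have := @c_decr (i + j); lia.
Qed.

Lemma hvector_le_ci (s i : nat) :
  0 < s -> s <= k -> c s <= s -> c i <= ci_hvector k s i.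
Proof.
move=> s0 lesk hs; rewrite /ci_hvector.
have h1 := c_le i.
have le_s j : c j <= s.
  case: (leqP s j) => hj; first exact: leq_trans (hvector_noninc hs hj) hs.
  by have := c_le j; lia.
have h2 := le_s i; have h3 := le_s k.-1.
case: (leqP k i.+1) => hi; last by lia.
by have := @hvector_tail k.-1 (i - k.-1); rewrite subnKC; lia.
Qed.

(** Strict decrease down to a nonzero entry in degree [k + s - 2] forces at least [k + s - 1 - j] in
    each degree [j >= k - 1]; [hvector_ge] carries the bound [s] of degree [k - 1] back to lower
    degrees. *)
Lemma hvector_ge_ci (s i : nat) :
  0 < s -> s <= k -> 0 < c (k + s - 2) -> ci_hvector k s i <= c i.
Proof.
move=> s0 lesk hs; rewrite /ci_hvector.
have tail j : k <= j.+1 -> k + s - j.+1 <= c j.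
  move=> hj; case: (leqP j (k + s - 2)) => h; last by lia.
  by have := @hvector_tail j (k + s - 2 - j); rewrite subnKC; lia.
case: (leqP k i.+1) => hi; first by have := tail i hi; lia.
by have := @hvector_ge i k.-1; have := tail k.-1; lia.
Qed.

(** Degree [k - 2 + j] is paired with degree [k - 3 - j]; past the last pair [c] is zero. *)
Lemma hvector_half (M : nat) :
  2 < k -> c (k - 3) <= k - 3 ->
  \sum_(k - 2 <= i < M) c i <= \sum_(i < k - 2) c i.
Proof.
move=> k3 ha; pose n := k - 2.
have pair j : c (j + n) <= if j < n then c (n - j.+1) else 0.
  have h0 := @c_noninc (k - 3); have n1 : (k - 3).+1 = n by lia.
  rewrite n1 in h0.
  have h1 : c n.+1 <= c n by apply: c_noninc; lia.
  (* Strict decrease starts only at degree [k - 1 = n + 1], hence [j - 1]; the bound [c n <= n - 1]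
     makes up for the lost unit. *)
  have h2 : 0 < j -> c (j + n) <= c n - j.-1.
    move=> j0; have := @hvector_tail n.+1 j.-1.
    have -> : n.+1 + j.-1 = j + n by lia.
    lia.
  have h3 : j < n -> minn (n - j) (c n) <= c (n - j.+1).
    move=> hj; have := @hvector_ge (n - j.+1) n.
    have -> : (n - j.+1).+1 = n - j by lia.
    lia.
  case: ifP => hj; first case: (posnP j) => j0.
  - by move: (h3 hj); rewrite j0 add0n; lia.
  - by move: (h2 j0) (h3 hj); lia.
  by move: h2; lia.
rewrite -/n -{1}[n]add0n big_addn big_mkord.
pose G j := if j < n then c (n - j.+1) else 0.
apply: (@leq_trans (\sum_(j < M - n) G j)).
  by apply: leq_sum => j _; exact: pair.
have -> : \sum_(i < n) c i = \sum_(0 <= i < n) G i.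
  rewrite big_mkord (reindex_inj rev_ord_inj) /=.
  by apply: eq_bigr => i _; rewrite /G ltn_ord.
rewrite -(big_mkord xpredT G); case: (leqP (M - n) n) => h.
  by rewrite (big_cat_nat (leq0n _) h) //= leq_addr.
rewrite (big_cat_nat (leq0n _) (ltnW h)) //=.
have -> : \sum_(n <= i < M - n) G i = 0; last by rewrite addn0.
rewrite big_nat_cond big1 // => i /andP[/andP[hi _] _].
by rewrite /G ltnNge hi.
Qed.

End HVector.

(** * Linear algebra *)

Local Open Scope ring_scope.

Lemma closed_eigenvalue (F : closedFieldType) n (A : 'M[F]_n) :
  (0 < n)%N -> exists a, eigenvalue A a.
Proof.
move=> n0; have /closed_rootP[a] : size (char_poly A) != 1%N.
  by rewrite size_char_poly; lia.
by rewrite -eigenvalue_root_char; exists a.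
Qed.

(** Either [A] has a left kernel, or it is square and invertible and an eigenvector of [B A^-1]
    serves. *)
Lemma singular_pencil (F : closedFieldType) m n (A B : 'M[F]_(m, n)) :
  (0 < m)%N -> (n <= m)%N ->
  exists v : 'rV_m, exists2 ab : F * F,
    v != 0 /\ ab != 0 & v *m (ab.1 *: A + ab.2 *: B) = 0.
Proof.
move=> m0 lenm; have [fA | nfA] := boolP (row_free A); last first.
  have := nfA; rewrite -kermx_eq0 => /rowV0Pn[v /sub_kermxP vA v0].
  exists v, (1, 0) => /=; last by rewrite scale1r scale0r addr0.
  by split=> //; rewrite xpair_eqE oner_eq0.
have fullA : row_full A.
  by rewrite -col_leq_rank (leq_trans lenm) // row_leq_rank.
have [a /eigenvalueP[v vBA v0]] := closed_eigenvalue (B *m pinvmx A) m0.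
exists v, (- a, 1) => /=.
  by split=> //; rewrite xpair_eqE oner_eq0 andbF.
have vB : v *m B = a *: (v *m A).
  by rewrite scalemxAl -vBA -mulmxA -(mulmxA B) mulVpmx // mulmx1.
by rewrite scale1r mulmxDr vB -scalemxAr scaleNr addNr.
Qed.

Section Filtration.

Variables (F : fieldType) (N : nat).
Implicit Types (D f g : 'M[F]_N) (w : 'rV[F]_N).

Lemma mxrank_mul_coker m (U : 'M[F]_(m, N)) D :
  (\rank (U *m cokermx D) + \rank (U :&: D)%MS)%N = \rank U.
Proof.
rewrite -(mxrank_mul_ker U (cokermx D)); congr addn.
apply/eqmx_rank/rV_eqP => w; rewrite !sub_capmx; congr andb.
by rewrite sub_kermx submxE.
Qed.

(** [K] is the kernel of the map from [D1] to [D0 / D1] induced by [f]; [cokermx D1] stands for the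
    quotient map. *)
Lemma rank_stable D0 D1 f :
  (D1 *m f <= D0)%MS -> (D1 <= D0)%MS ->
  exists2 K : 'M[F]_N,
    (forall w, (w <= K)%MS = (w <= D1)%MS && (w *m f <= D1)%MS)
    & (\rank D1 + \rank D1 <= \rank D0 + \rank K)%N.
Proof.
move=> fD s10; exists (D1 :&: kermx (f *m cokermx D1))%MS.
  by move=> w; rewrite sub_capmx sub_kermx mulmxA -submxE.
rewrite -{2}(mxrank_mul_ker D1 (f *m cokermx D1)) addnA leq_add2r.
rewrite -(mxrank_mul_coker D0 D1) addnC leq_add //.
  by rewrite mulmxA mxrankS // submxMr.
by rewrite mxrankS // sub_capmx submx_refl s10.
Qed.

End Filtration.

(** [f] and [g] induce maps from a complement [U] of [D2] in [D1] to [D0 / D1], whose dimension is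
    at most that of [U]; a singular member of this pencil yields [w]. *)
Lemma pencil_stable (F : closedFieldType) (N : nat) (D0 D1 D2 f g : 'M[F]_N) :
  (D1 *m f <= D0)%MS -> (D1 *m g <= D0)%MS ->
  (D1 <= D0)%MS -> (D2 <= D1)%MS -> (\rank D2 < \rank D1)%N ->
  (\rank D0 + \rank D2 <= \rank D1 + \rank D1)%N ->
  exists w : 'rV_N, exists2 ab : F * F,
    [/\ (w <= D1)%MS, ~~ (w <= D2)%MS & ab != 0]
    & (w *m (ab.1 *: f + ab.2 *: g) <= D1)%MS.
Proof.
move=> fD gD s10 s21 lt21 le012.
pose U := row_base (D1 :\: D2)%MS; pose W := row_base (D0 *m cokermx D1).
have U1 : (U <= D1)%MS by rewrite eq_row_base diffmxSl.
have subW h : (D1 *m h <= D0)%MS -> (U *m (h *m cokermx D1) <= W)%MS.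
  move=> hD; rewrite eq_row_base mulmxA submxMr //.
  exact: submx_trans (submxMr _ U1) hD.
have /submxP[A defA] := subW f fD; have /submxP[B defB] := subW g gD.
have rU := mxrank_cap_compl D1 D2; rewrite -/U in rU.
have rW := mxrank_mul_coker D0 D1.
have e1 : \rank (D1 :&: D2)%MS = \rank D2.
  by apply/eqmx_rank; rewrite capmxSr sub_capmx s21 submx_refl.
have e2 : \rank (D0 :&: D1)%MS = \rank D1.
  by apply/eqmx_rank; rewrite capmxSr sub_capmx s10 submx_refl.
rewrite e1 in rU; rewrite e2 in rW.
have U0 : (0 < \rank (D1 :\: D2))%N.
  by rewrite -(ltn_add2l (\rank D2)) addn0 rU.
have leWU : (\rank (D0 *m cokermx D1) <= \rank (D1 :\: D2))%N.
  rewrite -(leq_add2r (\rank D1)) rW -(leq_add2r (\rank D2)).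
  by rewrite addnAC [X in (_ <= X + _)%N]addnC rU.
have [v [ab [v0 ab0] vAB]] := singular_pencil A B U0 leWU.
exists (v *m U), ab; last first.
  rewrite submxE; apply/eqP.
  have -> : v *m U *m (ab.1 *: f + ab.2 *: g) *m cokermx D1
            = v *m (ab.1 *: A + ab.2 *: B) *m W.
    rewrite -3!mulmxA mulmxDl [X in _ = v *m X]mulmxDl -!scalemxAl.
    by rewrite -defA -defB mulmxDr -!scalemxAr.
  by rewrite vAB mul0mx.
split=> //; first exact: submx_trans (submxMl _ _) U1.
apply: contra v0 => vU2.
have : (v *m U <= (D1 :\: D2) :&: D2)%MS.
  by rewrite sub_capmx vU2 andbT (submx_trans (submxMl _ _)) // eq_row_base.
rewrite capmx_diff submx0 => /eqP vU0; apply/eqP.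
by apply: (row_free_inj (row_base_free _)); rewrite vU0 mul0mx.
Qed.

(** * Ternary forms and the line at infinity *)

Lemma dhomog_ind n (R : comNzRingType) (P : nat -> {mpoly R[n]} -> Prop) :
  P 0%N 1 -> (forall d, P d 0) ->
  (forall d c f g, P d f -> P d g -> P d (c *: f + g)) ->
  (forall d i f, f \is d.-homog -> P d f -> P d.+1 ('X_i * f)) ->
  forall d f, f \is d.-homog -> P d f.
Proof.
move=> P1 P0 PD PX.
have PM d : forall m : 'X_{1..n}, mdeg m = d -> P d 'X_[m].
  elim: d => [|d IH] m dm.
    by move/eqP: dm; rewrite mdeg_eq0 => /eqP ->; rewrite mpolyX0.
  have [i mi] : exists i, m i != 0%N.
    apply/existsP; apply: contra_eqT dm => /existsPn m0.
    by rewrite mdegE big1 // => i _; apply/eqP; rewrite -[_ == _]negbK m0.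
  have Um : (U_(i) <= m)%MM by rewrite lep1mP.
  have dm' : mdeg (m - U_(i))%MM = d.
    have := dm; rewrite -{1}(submK Um) mdegD mdeg1 addn1 => -[].
    by [].
  rewrite -(submK Um) addmC mpolyXD; apply: PX; last exact: IH.
  by rewrite dhomogX; apply/eqP.
move=> d f /dhomogP hf; rewrite [f]mpolyE big_seq.
elim/big_rec: _ => [|m g mf Pg]; first exact: P0.
by apply: PD => //; apply: PM; exact: hf.
Qed.

Lemma eq0_horner_closed (F : closedFieldType) (g : {poly F}) :
  (forall x, g.[x] = 0) -> g = 0.
Proof.
move=> g0; apply/eqP; apply: contraT => /closed_nonrootP[x].
by rewrite /root g0 eqxx.
Qed.

Lemma dhomogXU n (R : comNzRingType) (i : 'I_n) :
  ('X_i : {mpoly R[n]}) \is 1.-homog.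
Proof. by rewrite dhomogX; apply/eqP; exact: mdeg1. Qed.

Section AffineChart.

Variables (F : closedFieldType) (a b : F).

(* The point with last coordinates [x1], [x2] at which [infty_form] below takes
   the value [c]: an affine point for [c = 1], a point at infinity for [c = 0]. *)
Definition chart_pt (c x1 x2 : F) (i : 'I_3) : F :=
  [:: c - a * x1 - b * x2; x1; x2]`_i.

Definition X1 : {mpoly F[3]} := 'X_(@Ordinal 3 1 isT).
Definition X2 : {mpoly F[3]} := 'X_(@Ordinal 3 2 isT).
(** The coefficients [a] and [b] stay free so that this line can be moved off any given finite set
    of points. *)
Definition infty_form : {mpoly F[3]} := 'X_ord0 + a *: X1 + b *: X2.

Lemma X1_homog : X1 \is 1.-homog. Proof. exact: dhomogXU. Qed.
Lemma X2_homog : X2 \is 1.-homog. Proof. exact: dhomogXU. Qed.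

Lemma infty_form_homog : infty_form \is 1.-homog.
Proof.
rewrite /infty_form !rpredD ?rpredZ ?X1_homog ?X2_homog //.
exact: dhomogXU.
Qed.

Lemma meval_X1 c x1 x2 : X1.@[chart_pt c x1 x2] = x1.
Proof. by rewrite mevalXU. Qed.

Lemma meval_X2 c x1 x2 : X2.@[chart_pt c x1 x2] = x2.
Proof. by rewrite mevalXU. Qed.

Lemma meval_infty_form c x1 x2 : infty_form.@[chart_pt c x1 x2] = c.
Proof.
rewrite /infty_form !mevalD !mevalZ meval_X1 meval_X2 mevalXU /chart_pt /=.
by ring.
Qed.

Lemma binomial_form_homog (d u : nat) :
  (u <= d)%N -> X1 ^+ u * X2 ^+ (d - u) \is d.-homog.
Proof.
move=> leud; have -> : d = (1 * u + 1 * (d - u))%N by lia.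
have -> : (1 * u + 1 * (d - u) - u = d - u)%N by lia.
by apply: dhomogM; apply: dhomogMn; [exact: X1_homog | exact: X2_homog].
Qed.

Definition binary_form (d : nat) (g : nat -> F) : {mpoly F[3]} :=
  \sum_(i < d.+1) g i *: (X1 ^+ i * X2 ^+ (d - i)).

(** Modulo [infty_form] the first variable is [- a X1 - b X2], which leaves a form in [X1] and [X2].
    In degree 0 the quotient would have degree -1, hence is 0. *)
Lemma homog_mod_infty d f : f \is d.-homog ->
  exists g h, f = binary_form d g + infty_form * h /\
    (if d is d'.+1 then h \is d'.-homog else h = 0).
Proof.
move: d f.
pose P d f := exists g h, f = binary_form d g + infty_form * h /\
    (if d is d'.+1 then h \is d'.-homog else h = 0).
have PD d c f g : P d f -> P d g -> P d (c *: f + g).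
  move=> [g1 [h1 [-> hh1]]] [g2 [h2 [-> hh2]]].
  exists (fun i => c * g1 i + g2 i), (c *: h1 + h2); split; last first.
    case: d hh1 hh2 => [->->|d hh1 hh2]; first by rewrite scaler0 addr0.
    by rewrite rpredD ?rpredZ.
  rewrite scalerDr mulrDr -scalerAr addrACA; congr (_ + _).
  rewrite /binary_form scaler_sumr -big_split /=.
  by apply: eq_bigr => i _; rewrite scalerA scalerDl.
have P0 d : P d 0.
  exists (fun _ => 0), 0; split; last by case: d => // d; exact: rpred0.
  by rewrite /binary_form big1 ?mulr0 ?addr0 // => i _; rewrite scale0r.
have PX1 d f : P d f -> P d.+1 (X1 * f).
  move=> [g [h [-> hh]]].
  exists (fun i => if i is i'.+1 then g i' else 0), (X1 * h); split.
    rewrite mulrDr mulrCA; congr (_ + _).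
    rewrite /binary_form [in RHS]big_ord_recl /= scale0r add0r mulr_sumr.
    apply: eq_bigr => i _; rewrite -scalerAr mulrA -exprS.
    by rewrite /= /bump add1n subSS.
  case: d hh => [->|d hh]; first by rewrite mulr0 rpred0.
  exact: dhomogM X1_homog hh.
have PX2 d f : P d f -> P d.+1 (X2 * f).
  move=> [g [h [-> hh]]].
  exists (fun i => if i == d.+1 then 0 else g i), (X2 * h); split.
    rewrite mulrDr mulrCA; congr (_ + _).
    rewrite /binary_form [in RHS]big_ord_recr /= eqxx scale0r addr0 mulr_sumr.
    apply: eq_bigr => i _; rewrite -scalerAr mulrCA -exprS.
    by rewrite ltn_eqF // -subSn // -ltnS.
  case: d hh => [->|d hh]; first by rewrite mulr0 rpred0.
  exact: dhomogM X2_homog hh.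
apply: (@dhomog_ind _ _ P) => //.
  exists (fun _ => 1), 0; split=> //.
  rewrite /binary_form big_ord_recl big_ord0.
  by rewrite !expr0 mulr1 scale1r mulr0 !addr0.
move=> d i f hf Pf; case: i => [[|[|[|//]]] hi].
- have -> : 'X_(Ordinal hi) = infty_form - a *: X1 - b *: X2.
    rewrite /infty_form (_ : Ordinal hi = ord0); last exact: val_inj.
    by rewrite addrAC addrK addrK.
  have -> : (infty_form - a *: X1 - b *: X2) * f =
     (- a) *: (X1 * f) + ((- b) *: (X2 * f) + infty_form * f).
    by rewrite !mulrBl -!scalerAl !scaleNr [RHS]addrA [RHS]addrC addrA.
  apply: (PD _ _ _ _ (PX1 _ _ Pf)); apply: (PD _ _ _ _ (PX2 _ _ Pf)).
  exists (fun _ => 0), f; split=> //.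
  by rewrite /binary_form big1 ?add0r // => j _; rewrite scale0r.
- by rewrite (_ : Ordinal hi = @Ordinal 3 1 isT); [exact: PX1 | exact: val_inj].
- by rewrite (_ : Ordinal hi = @Ordinal 3 2 isT); [exact: PX2 | exact: val_inj].
Qed.

Lemma meval_binary_form d g x :
  (binary_form d g).@[chart_pt 0 x 1] = (\poly_(i < d.+1) g i).[x].
Proof.
rewrite horner_poly /binary_form raddf_sum; apply: eq_bigr => i _ /=.
by rewrite mevalZ mevalM !rmorphXn /= meval_X1 meval_X2 expr1n mulr1.
Qed.

Lemma binary_form_eq0 d g : \poly_(i < d.+1) g i = 0 -> binary_form d g = 0.
Proof.
move=> g0; rewrite /binary_form big1 // => i _.
by have := coef_poly d.+1 g i; rewrite g0 coef0 ltn_ord => <-; rewrite scale0r.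
Qed.

(** Once the highest power of [infty_form] is split off, the cofactor restricts to a nonzero binary
    form, which the points [(x : 1)] suffice to detect. *)
Lemma homog_off_infty d f : f \is d.-homog -> f != 0 ->
  exists e f' x, [/\ (e <= d)%N, f' \is e.-homog,
    f = infty_form ^+ (d - e) * f' & f'.@[chart_pt 0 x 1] != 0].
Proof.
elim/ltn_ind: d f => d IH f hf f0; have [g [h [ef hh]]] := homog_mod_infty hf.
have ev x : f.@[chart_pt 0 x 1] = (\poly_(i < d.+1) g i).[x].
  rewrite ef mevalD mevalM meval_infty_form mul0r addr0.
  exact: meval_binary_form.
have [/binary_form_eq0 g0|/closed_nonrootP[x gx]] :=
  eqVneq (\poly_(i < d.+1) g i) 0; last first.
  by exists d, f, x; rewrite leqnn ev subnn mul1r.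
rewrite g0 add0r in ef.
have h0 : h != 0 by apply: contraNneq f0 => h0; rewrite ef h0 mulr0.
case: d => [|d] in IH hf g g0 ev ef hh *; first by rewrite hh eqxx in h0.
have [e [f' [x [le_ed hf' eh f'x]]]] := IH d (ltnSn d) h hh h0.
exists e, f', x; split=> //; first exact: leqW.
by rewrite ef eh mulrA -exprS subSn.
Qed.

End AffineChart.

(** * Relations among evaluations *)

Section Relations.

Variables (F : closedFieldType) (a b : F) (N : nat) (y z : 'I_N -> F).

Let v (i : 'I_N) : 'I_3 -> F := chart_pt a b 1 (y i) (z i).

(** Row [r = u * j + t] codes the exponents [u] and [t]; it is zero, hence imposes no condition, if
    [u + t >= j]. *)
Definition monomial_values (j : nat) : 'M[F]_(j * j, N) :=
  \matrix_(r, i) if (r %/ j + r %% j < j)%N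
                 then y i ^+ (r %/ j) * z i ^+ (r %% j) else 0.

Definition supported (A : {set 'I_N}) : 'M[F]_N :=
  diag_mx (\row_i (i \in A)%:R).

(* Only degrees strictly below [j] are taken into account, so [relations A 0]
   consists of all the vectors supported on [A]. *)
Definition relations (A : {set 'I_N}) (j : nat) : 'M[F]_N :=
  (supported A :&: kermx (monomial_values j)^T)%MS.

Implicit Types (w : 'rV[F]_N) (A B : {set 'I_N}).

Lemma mul_rV_diag w (d : 'rV[F]_N) i : (w *m diag_mx d) 0 i = w 0 i * d 0 i.
Proof. by rewrite mul_mx_diag mxE. Qed.

Lemma supportedP w A :
  reflect (forall i, i \notin A -> w 0 i = 0) (w <= supported A)%MS.
Proof.
apply: (iffP submxP) => [[u ->] i iA | w0].
  by rewrite mul_rV_diag mxE (negPf iA) mulr0.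
exists w; apply/rowP => i; rewrite mul_rV_diag mxE.
by case: (boolP (i \in A)) => iA; rewrite ?mulr1 // w0 ?mul0r.
Qed.

Lemma rank_supported A : \rank (supported A) = #|A|.
Proof.
pose J : 'M[F]_(#|A|, N) := \matrix_(k, i) (i == enum_val k)%:R.
have JJ : J *m J^T = 1%:M.
  apply/matrixP => k l; rewrite !mxE (bigD1 (enum_val k)) //= big1 => [|i ik].
    by rewrite !mxE eqxx mul1r addr0 (inj_eq enum_val_inj).
  by rewrite !mxE (negPf ik) mul0r.
have defS : supported A = J^T *m J.
  apply/matrixP => i j; rewrite !mxE.
  transitivity (\sum_(x in A) ((i == x)%:R * (j == x)%:R : F)); last first.
    by rewrite big_enum_val; apply: eq_bigr => k _; rewrite !mxE.
  rewrite big_mkcond (bigD1 i) //= big1 => [|x xi]; last first.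
    by rewrite eq_sym (negPf xi) mul0r if_same.
  by rewrite eqxx mul1r addr0 [j == i]eq_sym; case: (i \in A); case: (i == j).
apply/eqP; rewrite eqn_leq; apply/andP; split.
  by rewrite defS mulmx_max_rank.
have -> : #|A| = \rank (J *m supported A *m J^T).
  by rewrite defS mulmxA JJ mul1mx JJ mxrank1.
exact: leq_trans (mxrankM_maxl _ _) (mxrankM_maxr _ _).
Qed.

Lemma relationsP w A j :
  reflect ((forall i, i \notin A -> w 0 i = 0) /\
    (forall u t, (u + t < j)%N -> \sum_i w 0 i * (y i ^+ u * z i ^+ t) = 0))
    (w <= relations A j)%MS.
Proof.
rewrite sub_capmx; apply: (iffP andP) => -[/supportedP wA].
  move=> /sub_kermxP wj; split=> // u t utj.
  have j0 : (0 < j)%N by lia.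
  have rj : (u * j + t < j * j)%N by nia.
  have := congr1 (fun M : 'rV_ _ => M 0 (Ordinal rj)) wj.
  rewrite !mxE => {2}<-; apply: eq_bigr => i _; rewrite !mxE /=.
  rewrite divnMDl // divn_small ?addn0; last by lia.
  by rewrite modnMDl modn_small ?utj //; lia.
move=> wj; split=> //; apply/sub_kermxP/rowP => r; rewrite !mxE.
have [utj|utj] := ltnP (r %/ j + r %% j) j.
  rewrite -[RHS](wj _ _ utj); apply: eq_bigr => i _.
  by rewrite !mxE utj.
by rewrite big1 // => i _; rewrite !mxE ltnNge utj /= mulr0.
Qed.

Lemma relations_homog w A j d f : (w <= relations A j)%MS ->
  f \is d.-homog -> (d < j)%N -> \sum_i w 0 i * f.@[v i] = 0.
Proof.
move=> /relationsP[_ wj] hf dj.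
(* The coordinates of [v i] are affine in [y i] and [z i], so the extra monomial factor absorbs the
   variables of [f] one at a time. *)
suff P : forall u t, (u + t + d < j)%N ->
    \sum_i w 0 i * (y i ^+ u * z i ^+ t * f.@[v i]) = 0.
  have := P 0%N 0%N dj; move=> {2}<-; apply: eq_bigr => i _.
  by rewrite !expr0 !mul1r.
move: d f hf {dj}; apply: dhomog_ind => [u t|d u t _|d c f g Pf Pg u t h|].
- rewrite addn0 => h; rewrite -[RHS](wj u t h); apply: eq_bigr => i _.
  by rewrite meval1 mulr1.
- by rewrite big1 // => i _; rewrite meval0 !mulr0.
- rewrite -[RHS]addr0 -[X in _ = _ + X](Pg u t h) -[X in _ = X + _](mulr0 c).
  rewrite -[X in _ = _ * X + _](Pf u t h) mulr_sumr -big_split /=.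
  by apply: eq_bigr => i _; rewrite mevalD mevalZ; ring.
move=> d k f _ Pf u t h.
have e1 := Pf u.+1 t; have e2 := Pf u t.+1; have e0 := Pf u t.
case: k => [[|[|[|//]]] hk].
- rewrite (eq_bigr (fun i => w 0 i * (y i ^+ u * z i ^+ t * f.@[v i])
    - a * (w 0 i * (y i ^+ u.+1 * z i ^+ t * f.@[v i]))
    - b * (w 0 i * (y i ^+ u * z i ^+ t.+1 * f.@[v i])))); last first.
    by move=> i _; rewrite mevalM mevalXU /v /chart_pt /= !exprS; ring.
  by rewrite !sumrB -!mulr_sumr e0 ?e1 ?e2 ?mulr0 ?subr0 //; lia.
- rewrite -[RHS]e1; last by lia.
  by apply: eq_bigr => i _; rewrite mevalM mevalXU /v /chart_pt /= exprS; ring.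
- rewrite -[RHS]e2; last by lia.
  by apply: eq_bigr => i _; rewrite mevalM mevalXU /v /chart_pt /= exprS; ring.
Qed.

Lemma relations_next w A m : (w <= relations A m)%MS ->
  (forall u, (u <= m)%N ->
    \sum_i w 0 i * (X1 F ^+ u * X2 F ^+ (m - u)).@[v i] = 0) ->
  (w <= relations A m.+1)%MS.
Proof.
move=> /relationsP[wA wm] top; apply/relationsP; split=> // u t.
move=> utm; have [|mut] := ltnP (u + t) m; first exact: wm.
have -> : t = (m - u)%N by lia.
rewrite -[RHS](top u); last by lia.
by apply: eq_bigr => i _; rewrite mevalM !rmorphXn /= meval_X1 meval_X2.
Qed.

Lemma relations_decr A j : (relations A j.+1 <= relations A j)%MS.
Proof.
apply/rV_subP => w /relationsP[wA wj]; apply/relationsP; split=> // u t h.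
by apply: wj; lia.
Qed.

Lemma relations0 A : (relations A 0 :=: supported A)%MS.
Proof.
apply/eqmxP/rV_eqP => w; apply/relationsP/supportedP => [[]//|wA].
by split.
Qed.

Lemma relations_mul A m c1 c2 w : (w <= relations A m.+1)%MS ->
  (w *m diag_mx (\row_i (c1 * y i + c2 * z i)%R) <= relations A m)%MS.
Proof.
move=> /relationsP[wA wj]; apply/relationsP; split=> [i iA|u t h].
  by rewrite mul_rV_diag wA ?mul0r.
rewrite (eq_bigr (fun i => c1 * (w 0 i * (y i ^+ u.+1 * z i ^+ t)) +
    c2 * (w 0 i * (y i ^+ u * z i ^+ t.+1)))); last first.
  by move=> i _; rewrite mul_rV_diag mxE !exprS; ring.
rewrite big_split -!mulr_sumr /= (wj u.+1 t) ?(wj u t.+1) //; try lia.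
by rewrite !mulr0 addr0.
Qed.

(* [(0 : x1 : x2)] is a point of the line at infinity and [x2 y - x1 z] an
   equation of the pencil of lines through it; modulo [w], every form of degree
   [m + 1] is congruent to its value there times [(r1 y + r2 z)^(m + 1)]. *)
Lemma relations_eval_infty A m w x1 x2 r1 r2 :
  (w <= relations A m.+1)%MS ->
  (w *m diag_mx (\row_i (x2 * y i - x1 * z i)%R) <= relations A m.+1)%MS ->
  r1 * x1 + r2 * x2 = 1 ->
  forall f, f \is m.+1.-homog ->
  \sum_i w 0 i * f.@[v i] =
    f.@[chart_pt a b 0 x1 x2] * \sum_i w 0 i * (r1 * y i + r2 * z i) ^+ m.+1.
Proof.
move=> wm lwm r12.
pose R := r1 *: X1 F + r2 *: X2 F.
have hR e : R ^+ e \is e.-homog.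
  rewrite -[X in X.-homog]mul1n; apply: dhomogMn.
  by rewrite rpredD ?rpredZ ?X1_homog ?X2_homog.
have evR i : R.@[v i] = r1 * y i + r2 * z i.
  by rewrite /R mevalD !mevalZ meval_X1 meval_X2.
(* Powers of [R], which is 1 at the point at infinity, pad forms of lower degree, so that induction
   on the degree applies. *)
suff P d f : f \is d.-homog -> (d <= m.+1)%N ->
    \sum_i w 0 i * (R ^+ (m.+1 - d) * f).@[v i] =
    f.@[chart_pt a b 0 x1 x2] * \sum_i w 0 i * (R ^+ m.+1).@[v i].
  move=> f hf; have := P _ f hf (leqnn _).
  rewrite subnn expr0 mul1r => ->; congr (_ * _).
  by apply: eq_bigr => i _; rewrite rmorphXn /= evR.
move: d f; apply: dhomog_ind => [_|d _|d c f g Pf Pg h|d k f hf Pf h].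
- by rewrite subn0 meval1 mul1r; apply: eq_bigr => i _; rewrite mulr1.
- rewrite meval0 mul0r big1 // => i _.
  by rewrite mulr0 meval0 mulr0.
- rewrite mevalD mevalZ mulrDl -mulrA -Pf // -Pg // mulr_sumr -big_split /=.
  by apply: eq_bigr => i _; rewrite !mevalM mevalD mevalZ; ring.
rewrite mevalM mevalXU -mulrA -Pf; last exact: ltnW.
pose g := R ^+ (m - d) * f.
have hg : g \is m.-homog.
  rewrite (_ : m = (m - d + d)%N); last by lia.
  by apply: dhomogM => //; rewrite addnK.
have g0 := relations_homog wm hg (ltnSn m).
have gl := relations_homog lwm hg (ltnSn m).
pose P := chart_pt a b 0 x1 x2.
(* Each coordinate is its value at infinity times [R], up to a multiple of the line's equation and a
   constant; by [gl] and [g0], [w] kills the products of both with [g]. *)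
have [k1 [k2 vk]] : exists k1 k2, forall i,
    v i k = P k * R.@[v i] + k1 * (x2 * y i - x1 * z i) + k2.
  case: k => [[|[|[|//]]] hk]; rewrite /P /v /chart_pt /=.
  - exists (b * r1 - a * r2), 1 => i; rewrite evR.
    have e : r2 * x2 = 1 - r1 * x1 by rewrite -r12; ring.
    by ring: e.
  - exists r2, 0 => i; rewrite evR.
    have e : r2 * x2 = 1 - r1 * x1 by rewrite -r12; ring.
    by ring: e.
  - exists (- r1), 0 => i; rewrite evR.
    have e : r2 * x2 = 1 - r1 * x1 by rewrite -r12; ring.
    by ring: e.
transitivity (\sum_i (P k * (w 0 i * (R ^+ (m.+1 - d) * f).@[v i]) +
   k1 * ((w *m diag_mx (\row_i (x2 * y i - x1 * z i)%R)) 0 i * g.@[v i]) +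
   k2 * (w 0 i * g.@[v i]))).
  apply: eq_bigr => i _; rewrite mul_rV_diag [in X in k1 * X]mxE.
  rewrite subSS subSn // exprS /g !mevalM mevalXU vk; ring.
by rewrite !big_split /= -!mulr_sumr g0 gl !mulr0 !addr0.
Qed.

End Relations.

(** * The h-vector of a set of points *)

Lemma rank_cap_ker_col (F : fieldType) m n (U : 'M[F]_(m, n)) (B : 'cV_n) :
  (\rank U <= (\rank (U :&: kermx B)%MS).+1)%N.
Proof.
rewrite -(mxrank_mul_ker U B) -[(\rank (_ :&: _)%MS).+1]add1n leq_add2r.
exact: rank_leq_col.
Qed.

Lemma unimodular_pair (F : fieldType) (x : F * F) : x != 0 ->
  exists r1 r2, r1 * x.1 + r2 * x.2 = 1.
Proof.
case: x => x1 x2; have [->|x10 _] := eqVneq x1 0; last first.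
  by exists x1^-1, 0; rewrite mulVf // mul0r addr0.
rewrite xpair_eqE eqxx /= => x20.
by exists 0, x2^-1; rewrite mulVf // mul0r add0r.
Qed.

Section HVectorOfPoints.

Variables (F : closedFieldType) (a b : F) (N : nat) (y z : 'I_N -> F).

Let v (i : 'I_N) : 'I_3 -> F := chart_pt a b 1 (y i) (z i).
Notation relations := (relations y z).
Implicit Types (w : 'rV[F]_N) (A B : {set 'I_N}).

Definition hvec A j := (\rank (relations A j) - \rank (relations A j.+1))%N.

Lemma rank_relations A j :
  \rank (relations A j) = (hvec A j + \rank (relations A j.+1))%N.
Proof. by rewrite subnK // mxrankS // relations_decr. Qed.

Lemma rank_relations_sum A j M : (j <= M)%N ->
  \rank (relations A j) =
    (\sum_(j <= i < M) hvec A i + \rank (relations A M))%N.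
Proof.
elim: M => [|M IH] jM.
  by move: jM; rewrite leqn0 => /eqP ->; rewrite big_geq.
have [->|jM'] := eqVneq j M.+1; first by rewrite big_geq.
have {}jM : (j <= M)%N by lia.
by rewrite IH // big_nat_recr //= -addnA -rank_relations.
Qed.

Lemma relations_mulmx A m c1 c2 :
  (relations A m.+1 *m diag_mx (\row_i (c1 * y i + c2 * z i)%R)
     <= relations A m)%MS.
Proof.
apply/row_subP => i; rewrite row_mul; apply: relations_mul.
exact: row_sub.
Qed.

(** The rank of [K] exceeds that of [relations A m.+2] by at least [hvec A m.+1 - hvec A m], so
    bounding [K] from above bounds the growth of the h-vector. *)
Lemma multiplier_kernel A m x1 x2 : exists2 K : 'M[F]_N,
  (forall w, (w <= K)%MS = (w <= relations A m.+1)%MS &&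
     (w *m diag_mx (\row_i (x2 * y i - x1 * z i)%R) <= relations A m.+1)%MS)
  & (\rank (relations A m.+1) + \rank (relations A m.+1)
     <= \rank (relations A m) + \rank K)%N.
Proof.
apply: rank_stable; last exact: relations_decr.
have := relations_mulmx A m x2 (- x1); congr (_ *m diag_mx _ <= _)%MS.
by apply/rowP => i; rewrite !mxE mulNr.
Qed.

Lemma relations_next_infty A m w x1 x2 r1 r2 :
  (w <= relations A m.+1)%MS ->
  (w *m diag_mx (\row_i (x2 * y i - x1 * z i)%R) <= relations A m.+1)%MS ->
  r1 * x1 + r2 * x2 = 1 ->
  \sum_i w 0 i * (r1 * y i + r2 * z i) ^+ m.+1 = 0 ->
  (w <= relations A m.+2)%MS.
Proof.
move=> wm lwm r12 w0; apply: (@relations_next _ a b) => // u um.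
rewrite (relations_eval_infty a b wm lwm r12) ?w0 ?mulr0 //.
exact: binomial_form_homog.
Qed.

(** In degree [m + 1], [w] is a multiple of evaluation at [x]; it kills [f], which is nonzero there,
    so the multiple is zero. *)
Lemma relations_next_form A m w (x : F * F) f : x != 0 ->
  (w <= relations A m.+1)%MS ->
  (w *m diag_mx (\row_i (x.2 * y i - x.1 * z i)%R) <= relations A m.+1)%MS ->
  f \is m.+1.-homog -> (forall i, i \in A -> f.@[v i] = 0) ->
  f.@[chart_pt a b 0 x.1 x.2] != 0 ->
  (w <= relations A m.+2)%MS.
Proof.
move=> /unimodular_pair[r1 [r2 r12]] wm lwm hf fA fx.
apply: (relations_next_infty wm lwm r12).
have := relations_eval_infty a b wm lwm r12 hf; rewrite big1 => [|i _].
  by move/esym/eqP; rewrite mulf_eq0 (negPf fx) /= => /eqP.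
have /relationsP[wA _] := wm.
by have [/fA ->|/wA ->] := boolP (i \in A); rewrite ?mulr0 ?mul0r.
Qed.

Lemma hvec_le_form A m f (x : F * F) : x != 0 ->
  f \is m.+1.-homog -> (forall i, i \in A -> f.@[v i] = 0) ->
  f.@[chart_pt a b 0 x.1 x.2] != 0 ->
  (hvec A m.+1 <= hvec A m)%N.
Proof.
move=> x0 hf fA fx; have [K defK rK] := multiplier_kernel A m x.1 x.2.
have leK : (\rank K <= \rank (relations A m.+2))%N.
  apply/mxrankS/rV_subP => w; rewrite defK => /andP[wm lwm].
  exact: relations_next_form x0 wm lwm hf fA fx.
have := rank_relations A m; have := rank_relations A m.+1.
move: rK leK; move: (\rank _) (\rank _) (\rank _) (\rank _) => r0 r1 r2 r3.
by lia.
Qed.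

(** At the point [(0 : 0 : 1)], asking the multiple of evaluation to be zero is one linear condition
    on [K], and it leads into [relations A m.+2]. *)
Lemma hvec_succ_le A m : (hvec A m.+1 <= (hvec A m).+1)%N.
Proof.
have [K defK rK] := multiplier_kernel A m 0 1.
have leK : (\rank K <= (\rank (relations A m.+2)).+1)%N.
  apply: leq_trans (rank_cap_ker_col K (\col_i z i ^+ m.+1)) _.
  rewrite ltnS; apply/mxrankS/rV_subP => w.
  rewrite sub_capmx defK => /andP[/andP[wm lwm] /sub_kermxP wz].
  apply: (@relations_next_infty A m w 0 1 0 1) => //.
    by rewrite !mul0r mulr1 add0r.
  have := congr1 (fun M : 'rV_1 => M 0 0) wz; rewrite !mxE => E.
  rewrite -[RHS]E.
  by apply: eq_bigr => i _; rewrite mxE mul0r mul1r add0r.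
have := rank_relations A m; have := rank_relations A m.+1.
move: rK leK; move: (\rank _) (\rank _) (\rank _) (\rank _) => r0 r1 r2 r3.
by lia.
Qed.

Lemma hvec_le A m : (hvec A m <= m.+1)%N.
Proof.
elim: m => [|m IH]; last exact: leq_trans (hvec_succ_le A m) _.
have : (\rank (relations A 0) <= (\rank (relations A 1)).+1)%N.
  apply: leq_trans (rank_cap_ker_col _ (const_mx 1)) _.
  rewrite ltnS; apply/mxrankS/rV_subP => w.
  rewrite sub_capmx => /andP[w0 /sub_kermxP w1].
  apply: (@relations_next _ a b) => // u; rewrite leqn0 => /eqP ->.
  have := congr1 (fun M : 'rV_1 => M 0 0) w1; rewrite !mxE => E.
  rewrite -[RHS]E.
  by apply: eq_bigr => i _; rewrite mxE subnn !expr0 mulr1 meval1.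
by rewrite /hvec; lia.
Qed.

End HVectorOfPoints.

Lemma dhomog_prod1 n (R : comNzRingType) (I : Type) (r : seq I) (P : pred I)
    (L : I -> {mpoly R[n]}) :
  (forall i, L i \is 1.-homog) ->
  \prod_(i <- r | P i) L i \is (count P r).-homog.
Proof.
move=> hL; elim: r => [|i r IH]; first by rewrite big_nil dhomog1.
by rewrite big_cons /=; case: (P i) => //=; exact: dhomogM.
Qed.

Section HVectorBounds.

Variables (F : closedFieldType) (a b : F) (N : nat) (y z : 'I_N -> F).

Let v (i : 'I_N) : 'I_3 -> F := chart_pt a b 1 (y i) (z i).
Notation relations := (relations y z).
Notation hvec := (hvec y z).
Implicit Types (w : 'rV[F]_N) (A B : {set 'I_N}).

(* If [hvec A m < hvec A m.+1], every point [(x : 1)] at infinity has a relation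
   [w] that evaluates forms of degree [m + 1] at it; the relations [z w] then
   evaluate the binary forms of degree [m] at arbitrarily many points, hence
   separate them. *)
Lemma hvec_noninc A m : (hvec A m <= m)%N -> (hvec A m.+1 <= hvec A m)%N.
Proof.
apply: contraTT; rewrite -!ltnNge => lt_hvec.
pose G : 'M[F]_(N, m.+1) := \matrix_(i, j) (y i ^+ j * z i ^+ (m - j)).
have kerG : (relations A m.+1 <= relations A m :&: kermx G)%MS.
  apply/rV_subP => w wm; rewrite sub_capmx (submx_trans wm) ?relations_decr //=.
  apply/sub_kermxP/rowP => j; rewrite !mxE.
  have /relationsP[_ wj] := wm; rewrite -[RHS](wj j (m - j)%N).
    by apply: eq_bigr => i _; rewrite mxE.
  by rewrite subnKC -ltnS.
suff fullG : row_full (relations A m *m G).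
  move: fullG; rewrite -col_leq_rank => /leq_trans; apply.
  rewrite -(leq_add2r (\rank (relations A m.+1))) -rank_relations.
  by rewrite -(mxrank_mul_ker (relations A m) G) leq_add2l mxrankS.
rewrite -[row_full _]/(\rank _ == _) -mxrank_tr -/(row_free _) -kermx_eq0.
apply/rowV0P => g /sub_kermxP gG.
(* A row [g] orthogonal to the image is a binary form of degree [m]; it is shown to vanish at every
   [(x : 1)]. *)
suff g0 : \poly_(j < m.+1) g 0 (inord j) = 0.
  apply/rowP => j; have := coef_poly m.+1 (fun j => g 0 (inord j)) j.
  by rewrite g0 coef0 ltn_ord inord_val mxE => <-.
apply: eq0_horner_closed => x; rewrite horner_poly.
have [K defK rK] := multiplier_kernel y z A m x 1.
have : ~~ (K <= relations A m.+2)%MS.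
  apply/negP => /mxrankS leK.
  have := rank_relations y z A m; have := rank_relations y z A m.+1.
  move: rK leK lt_hvec; move: (\rank _) (\rank _) (\rank _) (\rank _).
  by move=> r0 r1 r2 r3; lia.
case/row_subPn => i0; set w := row i0 K => wNm.
have := row_sub i0 K; rewrite defK -/w => /andP[wm lwm].
have e1 : 0 * x + 1 * 1 = 1 :> F by rewrite mul0r add0r mulr1.
pose s := \sum_i w 0 i * (0 * y i + 1 * z i) ^+ m.+1.
have s0 : s != 0.
  by apply: contra wNm => /eqP; exact: (relations_next_infty a b wm lwm e1).
apply: (mulIf s0); rewrite mul0r mulr_suml.
(* On binary forms of degree [m], [z w] acts as [s] times evaluation at [(x : 1)]; lying in
   [relations A m], it is orthogonal to [g]. *)
have zw := relations_mul 0 1 wm.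
have /submxP[u defzw] := zw.
have : (w *m diag_mx (\row_i (0 * y i + 1 * z i)%R)) *m G *m g^T = 0.
  rewrite defzw -!mulmxA.
  rewrite (mulmxA (relations A m)) -[_ *m g^T]trmxK trmx_mul trmxK gG.
  by rewrite trmx0 mulmx0.
move=> /(congr1 (fun M : 'M_1 => M 0 0)); rewrite !mxE => E.
rewrite -[RHS]E; apply: eq_bigr => j _; rewrite inord_val !mxE.
have hj : X1 F ^+ j * X2 F ^+ (m.+1 - j) \is m.+1.-homog.
  by apply: binomial_form_homog; exact: ltnW.
have := relations_eval_infty a b wm lwm e1 hj.
rewrite mevalM !rmorphXn /= meval_X1 meval_X2 expr1n mulr1 -/s => E'.
rewrite -mulrA -E' mulrC; congr (_ * _); apply: eq_bigr => i _.
rewrite mul_rV_diag !mxE mevalM !rmorphXn /= meval_X1 meval_X2.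
by rewrite subSn ?exprS; [ring | rewrite -ltnS].
Qed.

(** [infty_form] is 1 on the points, so its powers can be divided out, leaving degree [e <= m]. If
    [e > 0], then [hvec_le_form] and [hvec_le] give [hvec A e <= e], carried to [m] by
    [hvec_noninc]; if [e = 0], then [A] is empty. *)
Lemma hvec_le_of_form A m f : f \is m.-homog -> f != 0 ->
  (forall i, i \in A -> f.@[v i] = 0) -> (hvec A m <= m)%N.
Proof.
move=> hf f0 fA.
have [e [f' [x [le_em hf' ef f'x]]]] := homog_off_infty a b hf f0.
have f'A i : i \in A -> f'.@[v i] = 0.
  by move=> /fA; rewrite ef mevalM rmorphXn /= meval_infty_form expr1n mul1r.
suff le_e : (hvec A e <= e)%N.
  elim: m le_em {hf f0 ef fA} => [|m IH]; first by rewrite leqn0 => /eqP <-.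
  rewrite leq_eqVlt => /orP[/eqP <-//|]; rewrite ltnS => /IH h.
  exact: leq_trans (hvec_noninc h) (leqW h).
case: e => [|e] in hf' f'x f'A {ef le_em} *; last first.
  apply: leq_trans (hvec_le a b _ _ _ _).
  apply: (@hvec_le_form _ a b _ y z A e f' (x, 1)) => //.
  by rewrite xpair_eqE oner_eq0 andbF.
have [g [h [ef' h0]]] := homog_mod_infty a b hf'.
have evf c x1 x2 : f'.@[chart_pt a b c x1 x2] = g 0%N.
  rewrite ef' h0 mulr0 addr0 /binary_form big_ord_recl big_ord0 addr0.
  by rewrite mevalZ !expr0 mulr1 meval1 mulr1.
rewrite evf in f'x.
have -> : A = set0.
  by apply/setP => i; rewrite inE; apply: contraNF f'x => /f'A/eqP; rewrite evf.
by rewrite /hvec relations0 rank_supported cards0.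
Qed.

Section CommonZeros.

Variable k : nat.
Hypothesis no_zero_at_infty : forall x : F * F, x != 0 -> exists e f,
  [/\ (e <= k)%N, f \is e.-homog, forall i, f.@[v i] = 0
    & f.@[chart_pt a b 0 x.1 x.2] != 0].

Lemma hvec_decr A m :
  (k <= m.+1)%N -> (0 < hvec A m)%N -> (hvec A m.+1 < hvec A m)%N.
Proof.
move=> km h0; rewrite ltnNge; apply/negP => le_hvec.
have lt1 : (\rank (relations A m.+2) < \rank (relations A m.+1))%N.
  rewrite (rank_relations y z A m.+1) -addn1 addnC leq_add2r.
  exact: leq_trans le_hvec.
have le2 : (\rank (relations A m) + \rank (relations A m.+2)
   <= \rank (relations A m.+1) + \rank (relations A m.+1))%N.
  rewrite {1}(rank_relations y z A m) -addnA addnCA leq_add2l.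
  by rewrite (rank_relations y z A m.+1) leq_add2r.
have [w [c [wm wNm c0] lwm]] := pencil_stable (relations_mulmx y z A m 1 0)
  (relations_mulmx y z A m 0 1) (relations_decr y z A m)
  (relations_decr y z A m.+1) lt1 le2.
(* The point at infinity of the lines parallel to [c.1 y + c.2 z = 0]. *)
pose x : F * F := (- c.2, c.1).
have x0 : x != 0.
  move: c0; rewrite /x; case: (c) => c1 c2; rewrite !xpair_eqE oppr_eq0 /=.
  by rewrite andbC.
have [e [f [ek hf fv fx]]] := no_zero_at_infty x0.
have [r1 [r2 r12]] := unimodular_pair x0.
pose g := (r1 *: X1 F + r2 *: X2 F) ^+ (m.+1 - e) * f.
move/negP: wNm; apply.
apply: (@relations_next_form _ a b _ y z A m w x g) => //.
- move: lwm; congr (_ *m _ <= _)%MS; apply/matrixP => i j.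
  by rewrite !mxE /x /=; case: (i == j); rewrite ?mulr1n ?mulr0n; ring.
- have -> : m.+1 = (1 * (m.+1 - e) + e)%N by lia.
  rewrite /g; apply: dhomogM => //; apply: dhomogMn.
  by rewrite rpredD ?rpredZ ?X1_homog ?X2_homog.
- by move=> i _; rewrite mevalM fv mulr0.
rewrite mevalM rmorphXn /= mevalD !mevalZ meval_X1 meval_X2 r12.
by rewrite expr1n mul1r.
Qed.

End CommonZeros.

(** Every point other than [i0] lies on a line missing [i0]; the product of these [N - 1] lines
    isolates the weight at [i0]. *)
Lemma relations_large A j : injective (fun i => (y i, z i)) -> (N <= j)%N ->
  relations A j = 0.
Proof.
move=> yz_inj Nj; apply/eqP/rowV0P => w wj; apply/rowP => i0; rewrite mxE.
pose L i : {mpoly F[3]} := if y i == y i0 then X2 F - z i *: infty_form a b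
  else X1 F - y i *: infty_form a b.
have hL i : L i \is 1.-homog.
  by rewrite /L; case: ifP => _; rewrite rpredB ?rpredZ ?X1_homog ?X2_homog
    ?infty_form_homog.
pose f := \prod_(i | i != i0) L i.
have := relations_homog a b wj (dhomog_prod1 (index_enum _) (predC1 i0) hL).
rewrite -sum1_count sum1_card cardC1 card_ord -/f.
rewrite (bigD1 i0) //= big1 => [|i ii0]; last first.
  rewrite /f rmorph_prod (bigD1 i) //= {1}/L; case: ifP => _.
    by rewrite mevalB mevalZ meval_X2 meval_infty_form mulr1 subrr mul0r mulr0.
  by rewrite mevalB mevalZ meval_X1 meval_infty_form mulr1 subrr mul0r mulr0.
have i0N := ltn_ord i0.
rewrite addr0 => /(_ ltac:(lia))/eqP; rewrite mulf_eq0 => /orP[/eqP//|].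
rewrite /f rmorph_prod prodf_seq_eq0 => /hasP[i _ /andP[ii0]].
rewrite /L; have [yi|yi] /= := eqVneq (y i) (y i0).
   rewrite mevalB mevalZ meval_X2 meval_infty_form mulr1 subr_eq0 => /eqP zi.
  by case/eqP: ii0; apply: yz_inj; rewrite yi zi.
rewrite mevalB mevalZ meval_X1 meval_infty_form mulr1 subr_eq0 => /eqP yi'.
by rewrite yi' eqxx in yi.
Qed.

End HVectorBounds.

(** * Complete intersections *)

Section CompleteIntersection.

Variables (F : closedFieldType) (a b : F) (N : nat) (y z : 'I_N -> F).

Let v (i : 'I_N) : 'I_3 -> F := chart_pt a b 1 (y i) (z i).
Notation relations := (relations y z).
Notation hvec := (hvec y z).
Notation monomial_values := (monomial_values y z).
Implicit Types (w : 'rV[F]_N) (A B : {set 'I_N}).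

Lemma rank_monomial_values A j :
  (\rank (monomial_values j *m supported F A) + \rank (relations A j) = #|A|)%N.
Proof.
rewrite -(rank_supported F A).
rewrite -(mxrank_mul_ker (supported F A) (monomial_values j)^T).
rewrite -(mxrank_tr (_ *m supported F A)) trmx_mul.
by rewrite [(supported F A)^T]tr_diag_mx.
Qed.

Lemma homogenized_monomial_homog d u t : (u + t <= d)%N ->
  infty_form a b ^+ (d - (u + t)) * (X1 F ^+ u * X2 F ^+ t) \is d.-homog.
Proof.
move=> utd; have e : (1 * (d - (u + t)) + (1 * u + 1 * t) = d)%N by lia.
rewrite -[X in X.-homog]e; apply: dhomogM.
  exact/dhomogMn/infty_form_homog.
by apply: dhomogM; apply: dhomogMn; [exact: X1_homog | exact: X2_homog].
Qed.

(** Homogenizing with [infty_form], which is 1 on the points, turns polynomials of degree below [j]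
    into forms of degree [j - 1]. *)
Lemma monomial_values_form j (d : 'rV[F]_(j * j)) : (0 < j)%N ->
  exists2 f, f \is j.-1.-homog
    & forall i, f.@[v i] = (d *m monomial_values j) 0 i.
Proof.
move=> j0; pose f : {mpoly F[3]} := \sum_(r < j * j) if (r %/ j + r %% j < j)%N
  then d 0 r *: (infty_form a b ^+ (j.-1 - (r %/ j + r %% j)) *
                 (X1 F ^+ (r %/ j) * X2 F ^+ (r %% j))) else 0.
exists f => [|i].
  rewrite rpred_sum // => r _; case: ifP => // rj; last exact: rpred0.
  rewrite rpredZ //.
  by apply: homogenized_monomial_homog; lia.
rewrite /f raddf_sum mxE; apply: eq_bigr => r _; rewrite mxE /=.
case: ifP => _; last by rewrite meval0 mulr0.
rewrite mevalZ !mevalM !rmorphXn /= meval_infty_form meval_X1 meval_X2.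
by rewrite expr1n mul1r.
Qed.

Variables (k s : nat) (q : {mpoly F[3]}).
Hypotheses (s_gt0 : (0 < s)%N) (le_sk : (s <= k)%N) (k_gt2 : (2 < k)%N).
Hypothesis card_points : N = (k * s)%N.
Hypothesis points_inj : injective (fun i => (y i, z i)).
Hypotheses (q_homog : q \is s.-homog) (q_neq0 : q != 0).
Hypothesis q_zero : forall i, q.@[v i] = 0.
Hypothesis no_zero_at_infty : forall x : F * F, x != 0 -> exists e f,
  [/\ (e <= k)%N, f \is e.-homog, forall i, f.@[v i] = 0
    & f.@[chart_pt a b 0 x.1 x.2] != 0].

(** Large enough for the relations to vanish and for [ci_hvector k s] to have ended. *)
Let M := (k * s + k + s)%N.

Lemma rank_relations_tail A j : (j <= M)%N ->
  \rank (relations A j) = (\sum_(j <= i < M) hvec A i)%N.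
Proof.
move=> jM; rewrite (rank_relations_sum _ _ _ jM).
rewrite relations_large ?mxrank0 ?addn0 //.
by rewrite card_points /M; lia.
Qed.

Lemma card_hvec A : #|A| = (\sum_(i < M) hvec A i)%N.
Proof.
have <- : \rank (relations A 0) = #|A| by rewrite relations0 rank_supported.
by rewrite rank_relations_tail // big_mkord.
Qed.

Let hdecr A := hvec_decr no_zero_at_infty (A := A).

Lemma hvec_le_ci A i : (hvec A i <= ci_hvector k s i)%N.
Proof.
apply: hvector_le_ci => //.
- exact: hvec_le.
- exact: hvec_noninc.
- exact: hdecr.
exact: (hvec_le_of_form q_homog q_neq0 (fun i _ => q_zero i)).
Qed.

(** Both sides add up to [k s], so the termwise bound leaves no room. *)
Lemma hvec_ci i : (i < M)%N -> hvec setT i = ci_hvector k s i.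
Proof.
move=> iM; apply/eqP; rewrite eqn_leq hvec_le_ci /=.
have : (\sum_(i < M) (ci_hvector k s i - hvec setT i) = 0)%N.
  rewrite sumnB => [|j _]; last exact: hvec_le_ci.
  rewrite -card_hvec cardsT card_ord sum_ci_hvector ?card_points ?subnn //.
  by rewrite /M; lia.
by move/eqP; rewrite sum_nat_eq0 => /forallP/(_ (Ordinal iM)).
Qed.

Lemma rank_relations_last A :
  \rank (relations A (k + s - 2)) = hvec A (k + s - 2).
Proof.
rewrite rank_relations_tail; last by rewrite /M; lia.
rewrite big_ltn; last by rewrite /M; lia.
rewrite big_nat_cond big1 ?addn0 // => i /andP[/andP[ki _] _].
by have := hvec_le_ci A i; rewrite /ci_hvector; lia.
Qed.

(** A nonzero relation in the last degree is also one on its support [B]; [hvector_ge_ci] then gives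
    [B] at least [k s] points. *)
Lemma relations_nowhere0 :
  exists2 w : 'rV[F]_N,
    (w <= relations setT (k + s - 2))%MS & forall i, w 0 i != 0.
Proof.
have : \rank (relations setT (k + s - 2)) != 0%N.
  rewrite rank_relations_last hvec_ci /ci_hvector; last by rewrite /M; lia.
  by lia.
rewrite mxrank_eq0 => /rowV0Pn[w wT w0]; exists w => // i.
pose B := [set j | w 0 j != 0].
have wB : (w <= relations B (k + s - 2))%MS.
  have /relationsP[_ wj] := wT; apply/relationsP; split=> // j.
  by rewrite inE negbK => /eqP.
have : (0 < hvec B (k + s - 2))%N.
  rewrite -rank_relations_last lt0n mxrank_eq0; apply: contra w0 => /eqP B0.
  by rewrite B0 submx0 in wB.
move=> B0; suff /eqP/setP/(_ i) : B == setT by rewrite !inE.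
rewrite eqEcard subsetT cardsT card_ord /=.
apply: (@leq_trans (k * s)); first by rewrite card_points.
rewrite card_hvec -(@sum_ci_hvector k s M) //; last by rewrite /M; lia.
apply: leq_sum => j _; apply: hvector_ge_ci B0 => //.
- exact: hvec_noninc.
- exact: hdecr.
Qed.

(** By symmetry of the h-vector, there are as many relations in degree [s] as conditions imposed in
    degree [k - 3]. *)
Lemma rank_relations_dual :
  (\rank (relations setT s.+1) + \rank (relations setT (k - 2)) = N)%N.
Proof.
have cut j : (j <= M)%N ->
    (\sum_(i < j) ci_hvector k s i + \rank (relations setT j) = N)%N.
  move=> jM; rewrite rank_relations_tail // -[RHS]card_ord -cardsT card_hvec.
  rewrite -[RHS](big_mkord xpredT (hvec setT)) (big_cat_nat (leq0n _) jM) /=.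
  congr addn; rewrite big_mkord; apply: eq_bigr => i _.
  by rewrite hvec_ci // (leq_trans (ltn_ord i)).
have := sum_ci_hvector_sym le_sk (ltnW k_gt2); rewrite -card_points.
have := cut s.+1; have := cut (k - 2)%N.
move: (\rank _) (\rank _) => r1 r2; rewrite /M.
by lia.
Qed.

(** [A] is the complement of Gamma'. As Ind - Dep is the number of points minus twice Dep, this is
    the desired inequality. *)
Theorem relations_complete_intersection A :
  (0 < \rank (relations (~: A) s.+1))%N ->
  (#|A| + (\rank (relations (~: A) s.+1)).*2
     <= (\rank (relations setT s.+1)).*2)%N.
Proof.
move=> rA; have [w wT w0] := relations_nowhere0.
set R := relations setT s.+1; set E := monomial_values (k - 2).
have k2 : (0 < k - 2)%N by lia.
have wunit : diag_mx w \in unitmx.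
  rewrite unitmxE det_diag unitfE; apply/prodf_neq0 => i _; exact: w0.
have ER : (E *m diag_mx w <= R)%MS.
  apply/row_subP => r; apply/relationsP.
  split=> [i|u t h]; first by rewrite inE.
  have /relationsP[_ wj] := wT.
  have [rk|rk] := ltnP (r %/ (k - 2) + r %% (k - 2)) (k - 2).
    rewrite -[RHS](wj (r %/ (k - 2) + u)%N (r %% (k - 2) + t)%N); last by lia.
    apply: eq_bigr => i _; rewrite mxE mul_mx_diag !mxE rk !exprD; ring.
  rewrite big1 // => i _; rewrite mxE mul_mx_diag !mxE ltnNge rk /=.
  by rewrite !mul0r.
have rE B :
    \rank (E *m diag_mx w *m supported F B) = \rank (E *m supported F B).
  rewrite -mulmxA diag_mxC mulmxA mxrankMfree // row_free_unit //.
have suppT : supported F [set: 'I_N] = 1%:M.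
  apply/matrixP => i j; rewrite !mxE inE; by case: (i == j).
have rER : \rank (E *m diag_mx w) = \rank R.
  have := rank_monomial_values setT (k - 2); rewrite -rE suppT mulmx1.
  rewrite cardsT card_ord -/E => rET.
  apply: (@addIn (\rank (relations setT (k - 2)))).
  by rewrite rET rank_relations_dual.
have RE : (R <= E *m diag_mx w)%MS.
  by have := mxrank_leqif_sup ER; case=> _ <-; rewrite rER.
have subR : (relations (~: A) s.+1 <= R)%MS.
  apply/rV_subP => e /relationsP[_ ej]; apply/relationsP; split=> // i.
  by rewrite inE.
have half : ((\rank (relations A (k - 2))).*2 <= #|A|)%N.
  (* A nonzero relation off [A] is [w] times the values of a form of degree [k - 3]; as [w] has no
     zero weight, this form vanishes on [A]. *)
  have hA : (hvec A (k - 3) <= k - 3)%N.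
    move: rA; rewrite lt0n mxrank_eq0 => /rowV0Pn[e eA e0].
    have /submxP[d ed] := submx_trans (submx_trans eA subR) RE.
    have [f hf fd] := monomial_values_form d k2.
    have ev i : e 0 i = f.@[v i] * w 0 i.
      by rewrite fd ed mulmxA mul_rV_diag.
    have -> : (k - 3 = (k - 2).-1)%N by lia.
    apply: (hvec_le_of_form (a := a) (b := b) hf).
      apply: contraNneq e0 => f0; apply/eqP/rowP => i.
      by rewrite ev f0 meval0 mul0r mxE.
    move=> i iA; have /relationsP[eA0 _] := eA.
    have := eA0 i; rewrite inE iA ev => /(_ isT)/eqP.
    by rewrite mulf_eq0 (negPf (w0 i)) orbF => /eqP.
  have kM : (k - 2 <= M)%N by rewrite /M; lia.
  rewrite -addnn {1}rank_relations_tail // card_hvec.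
  rewrite -(big_mkord xpredT (hvec A)) (big_cat_nat (leq0n _) kM) /=.
  rewrite -rank_relations_tail // leq_add2r rank_relations_tail // big_mkord.
  apply: hvector_half => //.
  - exact: hvec_noninc.
  - exact: hdecr.
(* Restriction to [A] kills the relations carried by the complement, and the image of [R] has at
   least the rank of the forms of degree [k - 3] on [A]. *)
have rR : (\rank (E *m supported F A) + \rank (relations (~: A) s.+1)
           <= \rank R)%N.
  rewrite -(mxrank_mul_ker R (supported F A)) leq_add //.
    by rewrite -rE mxrankS // submxMr.
  apply: mxrankS; rewrite sub_capmx subR /=.
  apply/sub_kermxP/row_matrixP => r; rewrite row_mul row0.
  have /relationsP[e0 _] := row_sub r (relations (~: A) s.+1).
  apply/rowP => i; rewrite mul_rV_diag !mxE.
  have [iA|_] := boolP (i \in A); last by rewrite mulr0.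
  by have := e0 i; rewrite !mxE inE iA mulr1; apply.
have := rank_monomial_values A (k - 2); move: half rR; rewrite -/E.
by move: (\rank _) (\rank _) (\rank _) (\rank _) => r1 r2 r3 r4; lia.
Qed.

End CompleteIntersection.

(** * Points of the projective plane *)

Lemma meval_scale_homog n (R : comNzRingType) (c : R) (u1 u2 : 'I_n -> R) d f :
  (forall i, u1 i = c * u2 i) -> f \is d.-homog ->
  f.@[u1] = c ^+ d * f.@[u2].
Proof.
move=> u12; move: d f; apply: dhomog_ind => [|d|d e f g Pf Pg|d i f _ Pf].
- by rewrite !meval1 mulr1.
- by rewrite !meval0 mulr0.
- by rewrite !mevalD !mevalZ Pf Pg; ring.
by rewrite !mevalM !mevalXU Pf u12 exprS; ring.
Qed.

(** Along the coefficients [(1, t, t^2)], the value at a point is a nonzero polynomial in [t], so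
    some [t] is a root of none. *)
Lemma avoiding_infty_form (F : closedFieldType) (G : {fset proj 2 F}) :
  exists a b, forall x, x \in G -> (infty_form a b).@[rep x] != 0.
Proof.
pose P (x : proj 2 F) := Poly [seq rep x i | i <- enum 'I_3].
have : \prod_(x <- G) P x != 0.
  rewrite prodf_seq_neq0; apply/allP => x _ /=.
  have [i xi] := rep_neq0 x; apply: contraNneq xi => P0.
  have := coef_Poly [seq rep x i | i <- enum 'I_3] i; rewrite -/(P x) P0 coef0.
  by rewrite (nth_map i) ?size_enum_ord // nth_ord_enum => <-.
move=> /closed_nonrootP[t tP]; exists t, (t ^+ 2) => x xG.
move: tP; rewrite /root horner_prod prodf_seq_neq0 => /allP/(_ x xG) /=.
rewrite horner_Poly !enum_ordSl /= enum_ord0 /= mul0r add0r.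
rewrite /infty_form !mevalD !mevalZ !mevalXU; congr (_ != 0).
have -> : lift ord0 ord0 = @Ordinal 3 1 isT by apply: val_inj.
have -> : lift ord0 (lift ord0 ord0) = @Ordinal 3 2 isT by apply: val_inj.
by ring.
Qed.

Lemma mem_mx2vs (F : fieldType) (V : vectType F) m (M : 'M[F]_(m, dim V)) u :
  (u \in mx2vs M) = (v2r u <= M)%MS.
Proof. by rewrite -[LHS]/(<<v2r u>> <= <<M>>)%MS !genmxE. Qed.

Lemma dim_mx2vs (F : fieldType) (V : vectType F) m (M : 'M[F]_(m, dim V)) :
  \dim (mx2vs M) = \rank M.
Proof. by rewrite -[LHS]/(\rank <<M>>) mxrank_gen. Qed.

Lemma line_of_rep (F : fieldType) (x : proj 2 F) :
  line_of x = <[vpick (line_of x)]>%VS.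
Proof.
have dx : \dim (line_of x) == 1%N by case: x.
apply/esym/eqP; rewrite eqEdim -memvE memv_pick dim_vline (eqP dx) vpick0.
by rewrite -dimv_eq0 (eqP dx).
Qed.

Lemma rep_inj (F : fieldType) (x x' : proj 2 F) (c : F) :
  (forall i, rep x i = c * rep x' i) -> x = x'.
Proof.
move=> h; have e : vpick (line_of x) = c *: vpick (line_of x').
  by apply/rowP => i; rewrite mxE; exact: h.
apply: val_inj => /=; rewrite (line_of_rep x) (line_of_rep x') e.
apply/eqP; rewrite eqEdim -memvE memvZ ?memv_line //= !dim_vline -e !vpick0.
have dim1 (w : proj 2 F) : line_of w != 0%VS.
  by case: w => L dL; rewrite -dimv_eq0 (eqP dL).
by rewrite !dim1.
Qed.

Lemma proj_of_vector (F : fieldType) (u : 'I_3 -> F) i : u i != 0 ->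
  exists (x : proj 2 F) c, forall j, rep x j = c * u j.
Proof.
move=> ui; have u0 : \row_j u j != 0.
  by apply: contraNneq ui => /rowP/(_ i); rewrite !mxE => ->.
have d1 : \dim <[\row_j u j]>%VS == 1%N by rewrite dim_vline u0.
have /vlineP[c ec] := memv_pick <[\row_j u j]>%VS.
by exists (Proj d1), c => j; rewrite /rep /= ec !mxE.
Qed.

Section Normalization.

Variables (F : closedFieldType) (a b : F) (G : {fset proj 2 F}).
Hypothesis G_off_infty : forall x, x \in G -> (infty_form a b).@[rep x] != 0.

Definition point (i : 'I_#|` G|) : proj 2 F := tnth (in_tuple G) i.
Definition scale i : F := (infty_form a b).@[rep (point i)].
Definition affine1 i : F := rep (point i) (@Ordinal 3 1 isT) / scale i.
Definition affine2 i : F := rep (point i) (@Ordinal 3 2 isT) / scale i.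
Definition fset_indices (G' : {fset proj 2 F}) : {set 'I_#|` G|} :=
  [set i | point i \in G'].

Let v i : 'I_3 -> F := chart_pt a b 1 (affine1 i) (affine2 i).

Lemma point_in i : point i \in G.
Proof. exact: mem_tnth. Qed.

Lemma point_inj : injective point.
Proof. by apply/tuple_uniqP; exact: fset_uniq. Qed.

Lemma point_surj x : x \in G -> exists i, x = point i.
Proof. by move=> xG; apply/tnthP. Qed.

Lemma scale_neq0 i : scale i != 0.
Proof. exact/G_off_infty/point_in. Qed.

Lemma rep_point i j : rep (point i) j = scale i * v i j.
Proof.
have c0 := scale_neq0 i.
case: j => [[|[|[|//]]] hj]; rewrite /v /chart_pt /affine1 /affine2 /=.
- have es : scale i = rep (point i) ord0 + a * rep (point i) (@Ordinal 3 1 isT)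
      + b * rep (point i) (@Ordinal 3 2 isT).
    by rewrite /scale /infty_form !mevalD !mevalZ !mevalXU.
  rewrite (_ : Ordinal hj = ord0); last exact: val_inj.
  transitivity (scale i - a * rep (point i) (@Ordinal 3 1 isT)
      - b * rep (point i) (@Ordinal 3 2 isT)); first by rewrite es; ring.
  by field.
- by rewrite mulrC divfK //; congr rep; apply: val_inj.
- by rewrite mulrC divfK //; congr rep; apply: val_inj.
Qed.

Lemma meval_point i d f : f \is d.-homog ->
  f.@[rep (point i)] = scale i ^+ d * f.@[v i].
Proof. exact/meval_scale_homog/rep_point. Qed.

Lemma affine_inj : injective (fun i => (affine1 i, affine2 i)).
Proof.
move=> i j [e1 e2]; apply: point_inj.
apply: (@rep_inj F _ _ (scale i / scale j)) => u.
by rewrite !rep_point /v e1 e2 mulrA divfK ?scale_neq0.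
Qed.

Lemma card_fset_indices (G' : {fset proj 2 F}) :
  (G' `<=` G)%fset -> #|fset_indices G'| = #|` G'|.
Proof.
move=> sub; rewrite cardE -(size_map point).
apply: perm_size; apply: uniq_perm; rewrite ?fset_uniq //.
  by rewrite map_inj_uniq ?enum_uniq //; exact: point_inj.
move=> x; apply/mapP/idP => [[ i]|xG'].
  by rewrite mem_enum inE => iG' ->.
have [i xi] := point_surj (fsubsetP sub _ xG'); exists i => //.
by rewrite mem_enum inE -xi.
Qed.

(** Rank-nullity for the matrix [E] of evaluation functionals, restricted to vectors carried by
    [G']. *)
Lemma Dep_rank_relations m (G' : {fset proj 2 F}) : (G' `<=` G)%fset ->
  Dep m G' = \rank (relations affine1 affine2 (fset_indices G') m.+1).
Proof.
move=> sub; set A := fset_indices G'.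
(* The factor turns evaluation at the representative into evaluation at the normalized point
   [v i]. *)
pose phi i := (scale i ^+ m)^-1 *: evalf m (point i).
pose E := \matrix_i v2r (phi i).
have defE w : w *m E = v2r (\sum_i w 0 i *: phi i).
  rewrite mulmx_sum_row linear_sum; apply: eq_bigr => i _.
  by rewrite linearZ rowK.
have phiE i f : phi i f = (mpoly_of_dhomog f).@[v i].
  rewrite scale_lfunE evalfE (meval_point i (dhomog_is_dhomog f)).
  by rewrite [_ *: _]mulKf // expf_neq0 // scale_neq0.
have relE : (relations affine1 affine2 A m.+1 :=: supported F A :&: kermx E)%MS.
  apply/eqmxP/rV_eqP => w; rewrite sub_capmx.
  apply/idP/andP => [wm | [/supportedP wA /sub_kermxP]].
    have /relationsP[wA wj] := wm; split; first exact/supportedP.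
    apply/sub_kermxP; rewrite defE -(linear0 v2r); congr v2r.
    apply/lfunP => f; rewrite sum_lfunE zero_lfunE.
    rewrite -[RHS](relations_homog a b wm (dhomog_is_dhomog f) (ltnSn m)).
    by apply: eq_bigr => i _; rewrite scale_lfunE phiE.
  rewrite defE => /(congr1 r2v); rewrite v2rK linear0 => w0.
  apply/relationsP; split=> // u t utm.
  have hf := homogenized_monomial_homog a b (u := u) (t := t) utm.
  have := congr1 (fun g : 'Hom(_, _) => g (DHomog hf)) w0.
  rewrite sum_lfunE zero_lfunE => E0; rewrite -[RHS]E0; apply: eq_bigr => i _.
  rewrite scale_lfunE phiE /= mevalM !rmorphXn /= meval_infty_form expr1n mul1r.
  by rewrite mevalM !rmorphXn /= meval_X1 meval_X2.
have rE := mxrank_mul_ker (supported F A) E.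
rewrite -relE rank_supported card_fset_indices // in rE.
suff dimE : Ind m G' = \rank (supported F A *m E).
  by rewrite /Dep dimE -rE addKn.
rewrite -dim_mx2vs /Ind; congr (\dim _); apply/eqP; rewrite eqEsubv.
have rowSE i : row i (supported F A *m E) = (i \in A)%:R *: v2r (phi i).
  by rewrite row_mul row_diag_mx mxE -scalemxAl -rowE rowK.
apply/andP; split.
  apply/span_subvP => f /mapP[x xG' ->].
  have [i xi] := point_surj (fsubsetP sub _ xG').
  have iA : i \in A by rewrite inE -xi.
  rewrite mem_mx2vs; have := row_sub i (supported F A *m E).
  rewrite rowSE iA scale1r => /(scalemx_sub (scale i ^+ m)).
  rewrite -linearZ /phi scalerA mulfV ?scale1r -?xi //.
  by rewrite expf_neq0 // scale_neq0.
apply/subvP => f; rewrite mem_mx2vs => /submxP[d fd].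
rewrite -[f]v2rK fd mulmx_sum_row linear_sum; apply: memv_suml => i _.
rewrite linearZ /= rowSE linearZ /= v2rK memvZ //.
have [iA|_] := boolP (i \in A); last by rewrite scale0r mem0v.
rewrite scale1r memvZ // memv_span //; apply: map_f; by rewrite inE in iA.
Qed.

End Normalization.

Lemma Ind_Dep_complete_intersection (F : closedFieldType) (k s : nat)
    (p q : {mpoly F[3]}) (G G' : {fset proj 2 F}) :
  (3 <= s)%N -> (s <= k)%N -> is_curve k p -> is_curve s q ->
  transverse_intersection k s p q G -> (G' `<=` G)%fset ->
  (1 <= Dep s G')%N ->
  (Ind s G + Dep s G' <= Ind s G' + Dep s G)%N.
Proof.
move=> s3 sk [p_homog p0] [q_homog q0] [mem_G card_G] sub dep1.
have [a [b G_off]] := avoiding_infty_form G.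
pose y := affine1 a b (G := G); pose z := affine2 a b (G := G).
pose v i := chart_pt a b 1 (y i) (z i).
have zero d f : f \is d.-homog -> (forall x, x \in G -> on_curve f x) ->
    forall i, f.@[v i] = 0.
  move=> hf fG i; have /eqP := fG _ (point_in i).
  rewrite (meval_point G_off i hf) mulf_eq0 expf_eq0.
  by rewrite (negPf (scale_neq0 G_off i)) andbF => /eqP.
have pG x : x \in G -> on_curve p x by case/mem_G.
have qG x : x \in G -> on_curve q x by case/mem_G.
(* A common zero of [p] and [q] at infinity would belong to [G], which avoids that line. *)
have no_zero (x : F * F) : x != 0 -> exists e f,
  [/\ (e <= k)%N, f \is e.-homog, forall i, f.@[v i] = 0
    & f.@[chart_pt a b 0 x.1 x.2] != 0].
  move=> x0; set P := chart_pt a b 0 x.1 x.2.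
  have [pP|pP] := eqVneq p.@[P] 0; last first.
    by exists k, p; split=> //; exact: zero p_homog pG.
  have [qP|qP] := eqVneq q.@[P] 0; last first.
    by exists s, q; split=> //; exact: zero q_homog qG.
  have [j Pj] : exists j, P j != 0.
    have [x10|x10] := eqVneq x.1 0; last by exists (@Ordinal 3 1 isT).
    exists (@Ordinal 3 2 isT); apply: contraNneq x0 => x20.
    by rewrite -pair_eqE /pair_eq /= x10 eqxx; apply/eqP.
  have [w [c wP]] := proj_of_vector Pj.
  have /G_off : w \in G.
    apply/mem_G; rewrite /on_curve (meval_scale_homog wP p_homog).
    by rewrite (meval_scale_homog wP q_homog) pP qP !mulr0.
  rewrite (meval_scale_homog wP (infty_form_homog a b)) meval_infty_form.
  by rewrite mulr0 eqxx.
have DepA := Dep_rank_relations G_off s sub.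
have DepT := Dep_rank_relations G_off s (fsubset_refl G).
have GT : @fset_indices F G G = setT.
  by apply/setP => i; rewrite !inE point_in.
have := relations_complete_intersection (ltnW (ltnW s3)) sk (leq_trans s3 sk)
  card_G (affine_inj G_off) q_homog q0 (zero _ _ q_homog qG) no_zero
  (A := ~: @fset_indices F G G').
rewrite setCK -DepA -GT -DepT => /(_ dep1).
have := cardsC (@fset_indices F G G'); rewrite card_ord card_fset_indices //.
have := Ind_le_card s G; have := Ind_le_card s G'.
by rewrite /Dep; lia.
Qed.

Local Open Scope fset_scope.

Theorem theorem3p1 (R : realType) (k s : nat) (p q : {mpoly R[i][3]})
    (Gamma : {fset proj 2 R[i]}) :
  (3 <= s)%N -> (s <= k)%N ->
  is_curve k p -> is_curve s q ->
  transverse_intersection k s p q Gamma ->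
  forall Gamma' : {fset proj 2 R[i]},
    Gamma' `<=` Gamma ->
    (1 <= Dep s Gamma')%N ->
    (Ind s Gamma)%:Z - (Dep s Gamma)%:Z <= (Ind s Gamma')%:Z - (Dep s Gamma')%:Z.
Proof.
move=> s3 sk hp hq hG Gamma' sub dep1.
have : (Ind s Gamma + Dep s Gamma' <= Ind s Gamma' + Dep s Gamma)%N.
  exact: Ind_Dep_complete_intersection s3 sk hp hq hG sub dep1.
by lia.
Qed.
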